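(* Let $k\ge 2$ be an integer and let $b=(2^{k-1}-1)Q+R$ with non-negative integers $Q,R$ and $0\le R\le 2^{k-1}-2$. If $$Q\ge\begin{cases}R&\text{when } 0\le R\le 2^{k-2}-1,\\ R-2^{k-2}&\text{when }2^{k-2}\le R\le 2^{k-1}-2\end{cases}$$ (this is the case when $b\ge(2^{k-1}-1)(2^{k-2}-1)$), then $$m_k(b+2^{k-1}-1)=m_k(b)+2^k-1.$$
   Context: Let $\mathbb Z/2=\{0,1\}$ and let $(\ ,\ )$ denote the standard bilinear form (scalar product) on $(\mathbb Z/2)^k$ with values in $\mathbb Z/2$. For an integer $k\ge 2$ and a non-negative integer $b$, $m_k(b)$ is the maximum of $\sum_{v\in(\mathbb Z/2)^k\setminus\{0\}}a_v$ over all families of non-negative integers $(a_v)_{v\in(\mathbb Z/2)^k\setminus\{0\}}$ satisfying the $2^k-1$ inequalities $$\sum_{v\ne 0,\ (u,v)=0}a_v\le b\qquad\text{for each }u\in(\mathbb Z/2)^k\setminus\{0\}.$$ *)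

(* Defs.v *)
From mathcomp Require Import all_boot all_algebra.
From mathcomp Require Import boolp classical_sets.

Set Implicit Arguments.
Unset Strict Implicit.
Unset Printing Implicit Defensive.

Import GRing.Theory.

Notation "''V_' k" := 'rV['F_2]_k (at level 8, k at level 2).

Definition form (k : nat) (u v : 'V_k) : 'F_2 :=
  (\sum_(i < k) u 0 i * v 0 i)%R.

(* A family (a_v) indexed by the nonzero vectors is a function on all of 'V_k
   whose value at 0 is never used. *)
Definition admissible (k b : nat) (a : 'V_k -> nat) : Prop :=
  forall u : 'V_k, u != 0%R ->
    \sum_(v : 'V_k | (v != 0%R) && (form u v == 0%R)) a v <= b.

Definition weight (k : nat) (a : 'V_k -> nat) : nat :=
  \sum_(v : 'V_k | v != 0%R) a v.

Definition is_max_weight (k b n : nat) : Prop :=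
  (exists2 a : 'V_k -> nat, admissible b a & weight a = n) /\
  (forall a : 'V_k -> nat, admissible b a -> weight a <= n).

(* The maximum; for k < 2 it need not exist (for k = 1 the weights are
   unbounded) and the value is then the default 0.  See m_max for k >= 2. *)
Definition m (k b : nat) : nat := xget 0 (is_max_weight k b).

Lemma orthogonal_exists (k : nat) (v : 'V_k) :
  2 <= k -> exists2 u : 'V_k, u != 0%R & form u v = 0%R.
Proof.
case: k v => [|[|k]] // v _.
pose i0 : 'I_k.+2 := ord0; pose i1 : 'I_k.+2 := lift ord0 ord0.
have formE x y : form (x *: delta_mx 0 i0 + y *: delta_mx 0 i1)%R v
                 = (x * v 0 i0 + y * v 0 i1)%R.
  rewrite /form big_ord_recl big_ord_recl big1 ?addr0 => [|i _];
    by rewrite !mxE /= ?mulr0 ?mulr1 ?addr0 ?add0r ?mul0r.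
have [v0|v0] := eqVneq (v 0%R i0) 0%R.
  exists (1 *: delta_mx 0 i0 + 0 *: delta_mx 0 i1)%R.
    apply/eqP => /matrixP /(_ 0%R i0) /eqP.
    by rewrite !mxE /= mulr1 mul0r addr0 oner_eq0.
  by rewrite formE v0 mulr0 mul0r addr0.
exists (- v 0 i1 *: delta_mx 0 i0 + v 0 i0 *: delta_mx 0 i1)%R.
  apply/eqP => /matrixP /(_ 0%R i1) /eqP.
  by rewrite !mxE /= mulr0 mulr1 add0r (negPf v0).
by rewrite formE mulNr mulrC addNr.
Qed.

Lemma weight_bounded (k b : nat) (a : 'V_k -> nat) :
  2 <= k -> admissible b a -> weight a <= #|{: 'V_k}| * b.
Proof.
move=> k2 adm.
rewrite -sum_nat_const.
apply: (@leq_trans (\sum_(u : 'V_k | u != 0%R)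
    \sum_(v : 'V_k | (v != 0%R) && (form u v == 0%R)) a v)); last first.
  rewrite [leqRHS](bigID (fun u : 'V_k => u != 0%R)) /=.
  by apply: leq_trans (leq_addr _ _); apply: leq_sum => u; apply: adm.
rewrite (exchange_big_dep (fun v : 'V_k => v != 0%R)) /=; last first.
  by move=> u v _ /andP[].
apply: leq_sum => v vn0.
have [u un0 uv] := orthogonal_exists v k2.
by rewrite (bigD1 u) /= ?un0 ?vn0 ?uv ?eqxx // leq_addr.
Qed.

Lemma m_max (k b : nat) : 2 <= k -> is_max_weight k b (m k b).
Proof.
move=> k2.
pose P n := `[< exists2 a : 'V_k -> nat, admissible b a & weight a = n >].
have exP : exists n, P n.
  exists 0; apply/asboolP; exists (fun=> 0); last by rewrite /weight big1.
  by move=> u _; rewrite big1.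
have ubP n : P n -> n <= #|{: 'V_k}| * b.
  by move=> /asboolP[a adm <-]; apply: weight_bounded.
have [n /asboolP Pn nmax] := ex_maxnP exP ubP.
apply: (@xgetPex _ 0 (is_max_weight k b)); exists n; split=> // a adm.
by apply: nmax; apply/asboolP; exists a.
Qed.

(* Main.v *)
Require Import Defs.
From mathcomp Require Import all_boot all_algebra.
From mathcomp Require Import zify.

(** If a family for [b + 2 ^ (k - 1) - 1] has no zero coefficient, subtracting 1
    everywhere gives a family for [b].  Otherwise [a v = 0] for some [v], and
    averaging the inequalities over the hyperplanes that avoid [v] bounds the
    weight by [2 * (b + 2 ^ (k - 1) - 1)]; the condition on [Q] makes this at most
    [2 ^ k - 1] plus the weight of an explicit family for [b]: the constant family
    [Q], plus the complement of a hyperplane when [2 ^ (k - 2) <= R], plus a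
    multiple of a single vector. *)

Set Implicit Arguments.
Unset Strict Implicit.

Import GRing.Theory.
(* [all_algebra] shadows [Defs.form]. *)
Import Defs.

(** * The scalar product over ['F_2] *)

Lemma F2_add_eq0 (x y : 'F_2) : (x + y == 0)%R = ((x == 0%R) == (y == 0%R)).
Proof. by case: x y => [[|[|x]] ?] [[|[|y]] ?]. Qed.

Lemma formC (k : nat) (u v : 'V_k) : form u v = form v u.
Proof. by apply: eq_bigr => i _; rewrite mulrC. Qed.

Lemma formDl (k : nat) (u u' v : 'V_k) :
  form (u + u')%R v = (form u v + form u' v)%R.
Proof. by rewrite /form -big_split; apply: eq_bigr => i _; rewrite mxE mulrDl. Qed.

Lemma formDr (k : nat) (u v v' : 'V_k) :
  form u (v + v')%R = (form u v + form u v')%R.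
Proof. by rewrite formC formDl !(formC u). Qed.

Lemma form0l (k : nat) (v : 'V_k) : form 0%R v = 0%R.
Proof. by rewrite /form big1 // => i _; rewrite mxE mul0r. Qed.

Lemma form_nondegenerate (k : nat) (v : 'V_k) :
  v != 0%R -> exists e : 'V_k, form e v != 0%R.
Proof.
move=> /eqP vn0.
have [i vi] : exists i, v 0%R i != 0%R.
  apply/existsP; apply: contra_notT vn0 => /existsPn v0.
  by apply/rowP => i; rewrite mxE; apply/eqP; move: (v0 i); rewrite negbK.
exists (delta_mx 0%R i); rewrite /form (bigD1 i) //= big1 => [|j ji].
  by rewrite mxE !eqxx mul1r addr0.
by rewrite mxE (negPf ji) andbF mul0r.
Qed.

(** Take [e1] not orthogonal to [w] and [e2] not orthogonal to [v + w]. If neither works, then [e1]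
    takes the value 1 on both [v] and [w], while [e2] takes it on [v] only, so [e1 + e2] works. *)
Lemma form_separates (k : nat) (v w : 'V_k) : w != 0%R -> w != v ->
  exists2 e : 'V_k, form e v = 0%R & form e w != 0%R.
Proof.
move=> wn0 wv.
have [e1 e1w] := form_nondegenerate wn0.
have [/eqP e1v|e1v] := boolP (form e1 v == 0%R); first by exists e1.
have vw : (v + w != 0)%R.
  apply: contra_neqN wv => /eqP vw; rewrite -[w]add0r -vw -addrA.
  suff -> : (w + w = 0)%R by rewrite addr0.
  by apply/rowP => i; rewrite !mxE; apply/eqP; rewrite F2_add_eq0.
have [e2] := form_nondegenerate vw; rewrite formDr F2_add_eq0 => e2vw.
have [/eqP e2v|e2v] := boolP (form e2 v == 0%R).
  by exists e2 => //; move: e2vw; rewrite e2v eqxx; case: (form e2 w == 0%R).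
exists (e1 + e2)%R.
  by apply/eqP; rewrite formDl F2_add_eq0 (negPf e1v) (negPf e2v).
rewrite formDl F2_add_eq0 (negPf e1w).
by move: e2vw; rewrite (negPf e2v); case: (form e2 w == 0%R).
Qed.

(** * Counting vectors on and off hyperplanes *)

(** Translation by [e] maps [A] to itself and swaps the two values of [form _ w]. *)
Lemma card_halve (k : nat) (A : pred 'V_k) (e w : 'V_k) :
  (forall u, A (u + e)%R = A u) -> form e w != 0%R ->
  2 * #|[pred u | A u && (form u w == 0%R)]| = #|A| /\
  2 * #|[pred u | A u && (form u w != 0%R)]| = #|A|.
Proof.
move=> Ae ew.
have eqc : #|[pred u | A u && (form u w == 0%R)]|
         = #|[pred u | A u && (form u w != 0%R)]|.
  rewrite -!sum1_card (reindex_inj (addIr e)) /=; apply: eq_bigl => u.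
  by rewrite !inE Ae formDl F2_add_eq0 (negPf ew); case: (form u w == 0%R).
suff -> : #|A| = #|[pred u | A u && (form u w == 0%R)]|
                + #|[pred u | A u && (form u w != 0%R)]| by lia.
rewrite -(cardID [pred u | form u w == 0%R] A); congr (_ + _).
by apply: eq_card => u; rewrite !inE andbC.
Qed.

Lemma card_V (k : nat) : #|{: 'V_k}| = 2 ^ k.
Proof. by rewrite card_mx card_ord mul1n. Qed.

Lemma card_hyperplane (k : nat) (v : 'V_k) : v != 0%R ->
  2 * #|[pred u : 'V_k | form u v == 0%R]| = 2 ^ k /\
  2 * #|[pred u : 'V_k | form u v != 0%R]| = 2 ^ k.
Proof.
move=> /form_nondegenerate[e ev].
by have := @card_halve k predT e v (fun=> erefl) ev; rewrite /= card_V.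
Qed.

(** The vectors off the hyperplane of [v] are half of the space; a translation orthogonal to [v] but
    not to [w] halves them again. *)
Lemma card_hyperplaneD (k : nat) (v w : 'V_k) :
  v != 0%R -> w != 0%R -> w != v ->
  4 * #|[pred u : 'V_k | (form u v != 0%R) && (form u w == 0%R)]| = 2 ^ k.
Proof.
move=> vn0 wn0 wv.
have [e ev ew] := form_separates wn0 wv.
have [|+ _] := @card_halve k [pred u | form u v != 0%R] e w _ ew.
  by move=> u /=; rewrite formDl ev addr0.
have [_ <-] := card_hyperplane vn0.
by move=> /= <-; rewrite mulnA.
Qed.

Lemma card_hyperplane_neq0 (k : nat) (u : 'V_k) : u != 0%R ->
  2 * (#|[pred v : 'V_k | (v != 0%R) && (form u v == 0%R)]| + 1) = 2 ^ k.
Proof.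
move=> un0; have [<- _] := card_hyperplane un0; congr (2 * _).
rewrite [RHS](cardD1 (0%R : 'V_k)) !inE form0l eqxx addnC; congr (_ + _).
by apply: eq_card => v; rewrite !inE formC.
Qed.

(** * Explicit families, with their weights and bounds *)

Lemma weight_const (k c : nat) : weight (fun _ : 'V_k => c) = (2 ^ k - 1) * c.
Proof.
rewrite /weight sum_nat_const; congr (_ * _).
rewrite -card_V [in RHS](cardD1 (0%R : 'V_k)) inE add1n subn1.
by apply: eq_card => v; rewrite !inE andbT.
Qed.

Lemma weightD (k : nat) (a a' : 'V_k -> nat) :
  weight (fun v => a v + a' v) = weight a + weight a'.
Proof. exact: big_split. Qed.

Lemma admissible_const (k c : nat) :
  admissible ((2 ^ (k - 1) - 1) * c) (fun _ : 'V_k => c).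
Proof.
move=> u un0; rewrite sum_nat_const leq_mul2r; apply/orP; right.
(* For [k = 0] the count is contradictory: it equates an even number with 1. *)
have := card_hyperplane_neq0 un0; case: k u un0 => [|k] u un0; first by rewrite expn0; lia.
by rewrite expnS subSS subn0; set D := #|_|; lia.
Qed.

Lemma admissibleD (k b b' : nat) (a a' : 'V_k -> nat) :
  admissible b a -> admissible b' a' ->
  admissible (b + b') (fun v => a v + a' v).
Proof. by move=> adm adm' u un0; rewrite big_split leq_add ?adm ?adm'. Qed.

Lemma admissible_le_weight (k b : nat) (a : 'V_k -> nat) :
  weight a <= b -> admissible b a.
Proof.
move=> ab u _; apply: leq_trans ab.
rewrite /weight [leqRHS](bigID (fun v => form u v == 0%R)) /=.
exact: leq_addr.
Qed.

Lemma weight_delta (k c : nat) (v0 : 'V_k) : v0 != 0%R ->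
  weight (fun v => if v == v0 then c else 0) = c.
Proof.
move=> v0n0; rewrite /weight (bigD1 v0) //= eqxx big1 ?addn0 // => v.
by case/andP=> _ /negPf ->.
Qed.

Lemma expn2_half (k : nat) : 0 < k -> 2 ^ k = 2 * 2 ^ (k - 1).
Proof. by case: k => // k _; rewrite subSS subn0 expnS. Qed.

Lemma weight_affine (k : nat) (w : 'V_k) : 0 < k -> w != 0%R ->
  weight (fun v => (form v w != 0%R) : nat) = 2 ^ (k - 1).
Proof.
move=> k0 /card_hyperplane[_]; rewrite expn2_half // => /eqP.
rewrite eqn_mul2l /= => /eqP <-.
rewrite /weight -sum1_card [RHS]big_mkcond /= [LHS]big_mkcond /=.
apply: eq_bigr => v _; rewrite inE.
by case: eqP => // ->; rewrite form0l eqxx.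
Qed.

(** The family vanishes on the hyperplane of [w]; any other hyperplane meets its support in a
    quarter of the space. Its weight is thus twice the bound that it uses up. *)
Lemma admissible_affine (k : nat) (w : 'V_k) : 2 <= k -> w != 0%R ->
  admissible (2 ^ (k - 2)) (fun v => (form v w != 0%R) : nat).
Proof.
move=> k2 wn0 u un0.
have [->|uw] := eqVneq u w.
  by rewrite big1 // => v /andP[_]; rewrite formC => ->.
have := card_hyperplaneD wn0 un0 uw.
case: k k2 w wn0 u un0 uw => [|[|k]] // _ w wn0 u un0 uw.
rewrite !expnS !subSS subn0 mulnA => /eqP; rewrite eqn_mul2l /= => /eqP <-.
rewrite -sum1_card [leqRHS]big_mkcond /= big_mkcond /=.
apply: leq_sum => v _; rewrite inE (formC u).
by case: (v != 0%R); case: eqP; case: eqP.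
Qed.

(** * Bounds for weights and for [m] *)

Lemma m_ge (k b : nat) (a : 'V_k -> nat) :
  2 <= k -> admissible b a -> weight a <= m k b.
Proof. by move=> k2; have [_] := m_max b k2; apply. Qed.

Lemma exists_neq0 (k : nat) : 0 < k -> exists w : 'V_k, w != 0%R.
Proof.
case: k => // k _; exists (delta_mx 0%R ord0).
by apply/eqP => /rowP /(_ ord0) /eqP; rewrite !mxE.
Qed.

(* Each nonzero [w != v] lies on half of the hyperplanes that avoid [v]. *)
Lemma weight_avoiding (k b : nat) (a : 'V_k -> nat) (v : 'V_k) :
  admissible b a -> v != 0%R -> weight a <= 2 * b + a v.
Proof.
move=> adm vn0.
have [_ cv] := card_hyperplane vn0.
have cpos : 0 < #|[pred u : 'V_k | form u v != 0%R]|.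
  by have := expn_gt0 2 k; lia.
set C := #|_| in cv cpos.
(* [a v] is split off, since none of the [C] hyperplanes avoiding [v] sees it. *)
suff : C * \sum_(w | (w != 0%R) && (w != v)) a w <= C * (2 * b).
  by rewrite leq_pmul2l // => le; rewrite /weight (bigD1 v) //= addnC leq_add2r.
have sumb : \sum_(u : 'V_k | form u v != 0%R)
    \sum_(w : 'V_k | (w != 0%R) && (form u w == 0%R)) a w <= C * b.
  rewrite -sum_nat_const; apply: leq_sum => u uv; apply: adm.
  by apply: contra_neq uv => ->; rewrite form0l.
suff : C * \sum_(w | (w != 0%R) && (w != v)) a w
    <= 2 * \sum_(u : 'V_k | form u v != 0%R)
    \sum_(w : 'V_k | (w != 0%R) && (form u w == 0%R)) a w by lia.
rewrite (exchange_big_dep (fun w : 'V_k => w != 0%R)) /=; last first.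
  by move=> u w _ /andP[].
(* The term [w = v] is dropped; every other [a w] is counted [C / 2] times. *)
rewrite [X in 2 * X](bigID (fun w => w != v)) /= mulnDr.
apply: leq_trans (leq_addr _ _); rewrite !big_distrr /=.
apply: leq_sum => w /andP[wn0 wv].
under eq_bigl do rewrite wn0 /=.
rewrite sum_nat_const mulnA leq_mul2r; apply/orP; right.
have := card_hyperplaneD vn0 wn0 wv; rewrite -cv.
by set D := #|_|; lia.
Qed.

Lemma m_ge_multiples (k Q R : nat) : 2 <= k ->
  (2 ^ k - 1) * Q + R <= m k ((2 ^ (k - 1) - 1) * Q + R).
Proof.
move=> k2; have [w wn0] := @exists_neq0 k (ltnW k2).
rewrite -weight_const -[in leqLHS](weight_delta R wn0) -weightD.
apply: m_ge => //; apply: admissibleD; first exact: admissible_const.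
by apply: admissible_le_weight; rewrite weight_delta.
Qed.

(** Here [R] is what remains of the remainder after the complement of a hyperplane has used up
    [2 ^ (k - 2)]; it goes to a single vector. *)
Lemma m_ge_affine (k Q R : nat) : 2 <= k ->
  (2 ^ k - 1) * Q + (2 ^ (k - 1) + R)
    <= m k ((2 ^ (k - 1) - 1) * Q + (2 ^ (k - 2) + R)).
Proof.
move=> k2; have [w wn0] := @exists_neq0 k (ltnW k2).
rewrite -[in leqLHS](weight_affine (ltnW k2) wn0).
rewrite -weight_const -[in leqLHS](weight_delta R wn0) -!weightD.
apply: m_ge => //.
apply: admissibleD; first exact: admissible_const.
apply: admissibleD; first exact: admissible_affine.
by apply: admissible_le_weight; rewrite weight_delta.
Qed.

Lemma m_add_ge (k b : nat) : 2 <= k ->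
  m k b + (2 ^ k - 1) <= m k (b + (2 ^ (k - 1) - 1)).
Proof.
move=> k2; have [[a adm <-] _] := m_max b k2.
rewrite -[2 ^ k - 1]muln1 -[2 ^ (k - 1) - 1]muln1 -weight_const -weightD.
by apply: m_ge => //; apply: admissibleD => //; apply: admissible_const.
Qed.

Lemma m_add_le (k b : nat) : 2 <= k ->
  m k (b + (2 ^ (k - 1) - 1)) <=
    maxn (m k b + (2 ^ k - 1)) (2 * (b + (2 ^ (k - 1) - 1))).
Proof.
move=> k2; have [[a adm <-] _] := m_max (b + (2 ^ (k - 1) - 1)) k2.
rewrite leq_max; apply/orP.
have [/existsP[v /andP[vn0 /eqP av]]|/existsPn an0] :=
  boolP [exists v : 'V_k, (v != 0%R) && (a v == 0)].
  by right; have := weight_avoiding adm vn0; rewrite av addn0.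
(* Subtraction is truncated, so this needs [a v] to be nonzero. *)
left; have aE v : v != 0%R -> a v = a v - 1 + 1.
  by move=> vn0; have := an0 v; rewrite vn0 /=; lia.
rewrite {1}/weight (eq_bigr _ aE) -/(weight _) (weightD (fun v => a v - 1)).
rewrite weight_const muln1 leq_add2r; apply: m_ge => // u un0.
have := adm u un0; rewrite (eq_bigr (fun v => a v - 1 + 1)); last first.
  by move=> v /andP[/aE].
(* Subtracting 1 lowers each sum by the number of nonzero vectors in a hyperplane,
   [2 ^ (k - 1) - 1]. *)
rewrite big_split /= sum1_card.
have := card_hyperplane_neq0 un0; rewrite (expn2_half (ltnW k2)).
by set D := #|_|; lia.
Qed.

Unset Implicit Arguments.

Theorem theorem9p1 (k b Q R : nat) :
  2 <= k ->
  b = (2 ^ (k - 1) - 1) * Q + R ->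
  R <= 2 ^ (k - 1) - 2 ->
  ((2 ^ (k - 1) - 1) * (2 ^ (k - 2) - 1) <= b ->
     (if R <= 2 ^ (k - 2) - 1 then R else R - 2 ^ (k - 2)) <= Q) /\
  ((if R <= 2 ^ (k - 2) - 1 then R else R - 2 ^ (k - 2)) <= Q ->
     m k (b + (2 ^ (k - 1) - 1)) = m k b + (2 ^ k - 1)).
Proof.
move=> k2 bE Rle.
have Ek1 : 2 ^ (k - 1) = 2 * 2 ^ (k - 2) by rewrite -expnS; congr (2 ^ _); lia.
have Ek : 2 ^ k = 4 * 2 ^ (k - 2).
  by rewrite -[4]/(2 ^ 2) -expnD subnKC.
have ppos : 0 < 2 ^ (k - 2) by rewrite expn_gt0.
split=> [bge|QR].
  (* Since [R < 2 ^ (k - 1) - 1], [b] is less than [(2 ^ (k - 1) - 1) * (Q + 1)], so a smaller [Q]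
     would contradict [bge]. *)
  have Qge : 2 ^ (k - 2) - 1 <= Q.
    rewrite leqNgt; apply/negP => QP.
    have : (2 ^ (k - 1) - 1) * (Q + 1) <= (2 ^ (k - 1) - 1) * (2 ^ (k - 2) - 1).
      by rewrite leq_mul2l addn1 QP orbT.
    by rewrite mulnDr muln1; lia.
  by case: ifP => ?; lia.
apply/eqP; rewrite eqn_leq m_add_ge // andbT.
apply: leq_trans (m_add_le b k2) _; rewrite geq_max leqnn /=.
(* This is [2 * b <= m k b] with [Q] added to both sides. In each case the explicit family falls
   short of the left side by [R] or [R - 2 ^ (k - 2)], which [QR] bounds by [Q]. *)
have mb : (2 ^ k - 1) * Q + 2 * R <= m k b + Q.
  case: ifP QR => Rc QR.
    by have := m_ge_multiples Q R k2; rewrite -bE; lia.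
  have := m_ge_affine Q (R - 2 ^ (k - 2)) k2.
  by rewrite subnKC -?bE; lia.
have : (2 ^ k - 1) * Q = 2 * ((2 ^ (k - 1) - 1) * Q) + Q.
  by rewrite Ek Ek1 mulnA -{3}[Q]mul1n -mulnDl; congr (_ * _); lia.
by lia.
Qed.
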